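(* Let $A$ be a unital C$^*$-algebra and let $T:A\to A$ be a bounded linear map which is a triple derivation at zero with $T(1)=0$. Then $T$ is a $^*$-derivation, and hence a triple derivation.
   Context: For $a,b,c\in A$, $\{a,b,c\}=\frac12(ab^*c+cb^*a)$. A linear map $T:A\to A$ is a triple derivation at zero if $\{T(a),b,c\}+\{a,T(b),c\}+\{a,b,T(c)\}=0$ for all $a,b,c\in A$ with $\{a,b,c\}=0$. A triple derivation on $A$ is a linear map $\delta:A\to A$ with $\delta\{a,b,c\}=\{\delta(a),b,c\}+\{a,\delta(b),c\}+\{a,b,\delta(c)\}$ for all $a,b,c\in A$. A $^*$-derivation on $A$ is a linear map $D:A\to A$ with $D(ab)=D(a)b+aD(b)$ and $D(a^* )=D(a)^*$ for all $a,b\in A$. *)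

(* Defs.v *)
From HB Require Import structures.
From mathcomp Require Import all_boot all_order all_algebra.
From mathcomp Require Import complex.
From mathcomp Require Import all_classical all_reals all_analysis.

Set Implicit Arguments.
Unset Strict Implicit.
Unset Printing Implicit Defensive.

Import Order.TTheory GRing.Theory Num.Theory.
Import numFieldNormedType.Exports.

Local Open Scope ring_scope.
Local Open Scope complex_scope.

(* In a normed module over [R[i]] the norm takes its values in [R[i]]; they are
   nonnegative for the partial order of [R[i]], hence real.  Likewise
   [z <= w] in [R[i]] means that [w - z] is a nonnegative real.

   A single structure cannot inherit from both [GRing.Algebra] and
   [CompleteNormedModule]: Hierarchy-Builder rejects it, since the library's only
   join of rings with normed groups is [Num.NumDomain].  The product and the unit are
   therefore fields of the mixin, and the ring structure is declared afterwards as a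
   canonical instance. *)
HB.mixin Record isUnitalCStar (R : realType) A
    of CompleteNormedModule R[i] A := {
  cmul : A -> A -> A ;
  cone : A ;
  star : A -> A ;
  cmulA : associative cmul ;
  cmul1l : left_id cone cmul ;
  cmul1r : right_id cone cmul ;
  cmulDl : left_distributive cmul +%R ;
  cmulDr : right_distributive cmul +%R ;
  cmulZl : forall (k : R[i]) (x y : A), cmul (k *: x) y = k *: cmul x y ;
  cmulZr : forall (k : R[i]) (x y : A), cmul x (k *: y) = k *: cmul x y ;
  cnormM : forall x y : A, `|cmul x y| <= `|x| * `|y| ;
  starK : involutive star ;
  starD : {morph star : x y / x + y} ;
  starZ : forall (k : R[i]) (x : A), star (k *: x) = k^* *: star x ;
  cstarM : forall x y : A, star (cmul x y) = cmul (star y) (star x) ;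
  cstar_norm : forall x : A, `|cmul (star x) x| = `|x| ^+ 2
}.

#[short(type="unitalCStarAlgType")]
HB.structure Definition UnitalCStarAlgebra (R : realType) :=
  {A of CompleteNormedModule R[i] A & isUnitalCStar R A}.

HB.instance Definition _ (R : realType) (A : unitalCStarAlgType R) :=
  GRing.Zmodule_isPzRing.Build (UnitalCStarAlgebra.sort A)
    (@cmulA R A) (@cmul1l R A) (@cmul1r R A) (@cmulDl R A) (@cmulDr R A).

Section Definitions.
Variables (R : realType) (A : unitalCStarAlgType R).

Definition bounded_operator (T : {linear A -> A}) : Prop :=
  exists M : R, forall x : A, `|T x| <= M%:C * `|x|.

Definition triple (a b c : A) : A :=
  (2%:R^-1 : R[i]) *: (a * star b * c + c * star b * a).

Definition triple_derivation_at_zero (T : {linear A -> A}) : Prop :=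
  forall a b c : A, triple a b c = 0 ->
    triple (T a) b c + triple a (T b) c + triple a b (T c) = 0.

Definition triple_derivation (T : {linear A -> A}) : Prop :=
  forall a b c : A,
    T (triple a b c) = triple (T a) b c + triple a (T b) c + triple a b (T c).

Definition star_derivation (D : {linear A -> A}) : Prop :=
  (forall a b : A, D (a * b) = D a * b + a * D b) /\
  (forall a : A, D (star a) = star (D a)).

End Definitions.

(* Main.v *)
Require Import Defs.
From HB Require Import structures.
From mathcomp Require Import all_boot all_order all_algebra.
From mathcomp Require Import complex.
From mathcomp Require Import all_classical all_reals all_analysis.
From mathcomp Require Import ring lra zify.
From Stdlib Require Ncring Ncring_tac.
Import Order.TTheory GRing.Theory Num.Theory.
Import numFieldNormedType.Exports.
Set Implicit Arguments.
Unset Strict Implicit.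
Unset Printing Implicit Defensive.
Local Open Scope ring_scope.

(** The two identities [triple a 1 b = 0] and [triple a b 1 = 0] both hold when
    [a] and [b] are selfadjoint with [a * b = b * a = 0].  With [T 1 = 0], the
    hypothesis on [T] turns the first into
    [T a o b + a o T b = 0] and the second into [T a o b + a o (T b)^* = 0],
    where [x o y = x * y + y * x].  Their difference says that the map
    [S b = T b - (T b)^*] satisfies [a o S b = 0] for orthogonal [a] and [b].

    Fix a selfadjoint [h] and consider a bounded biadditive map [phi] on a closed
    commutative algebra of selfadjoint elements that contains [h].  If [phi]
    vanishes on orthogonal pairs then [phi h 1 = phi 1 h]
    ([zero_product_balanced]).  For [phi a b = a o S b] this reads [S h = 0], so
    [T] preserves selfadjointness ([map_selfadjoint]); for
    [phi a b = T (a * h) o b + (a * h) o T b] it reads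
    [T (h * h) = T h * h + h * T h] ([jordan_pair_selfadjoint]).  Polarization
    and the decomposition into real and imaginary parts then make [T] a Jordan
    derivation commuting with the involution, and a Jordan derivation of a
    semiprime ring without 2-torsion is a derivation
    ([jordan_derivation_is_derivation], an argument of Bresar).

    The balance property of [phi] needs many orthogonal pairs.  If
    [0 <= y <= n], the tent functions [e_0, ..., e_n] with peaks at the integers,
    applied to [y], form a partition of unity with [y = \sum_i i e_i] and
    [e_i * e_j = 0] for [1 < |i - j|].  Hence [phi y 1 - phi 1 y] reduces to the
    terms with neighbouring indices; splitting these into three classes of pairwise
    orthogonal tents bounds it independently of [n].  Taking for [y] large multiples
    of [h], shifted to be positive, forces [phi h 1 - phi 1 h = 0].

    No spectral theory is used to construct the tents.  The selfadjoint elements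
    that commute with the commutant of [h] form a real commutative Banach algebra
    in which [|a|^2 <= |a^2 + b^2|].  In such an algebra every [1 - x] with
    [|x| <= 1] is a square ([visser_limit]); squares are closed under addition
    ([psdD]); and every element is a difference of two orthogonal squares
    ([psd_decomp]).  The tents are made of such positive parts. *)

(** * Jordan derivations of semiprime rings *)

(** These instances let the normalization tactic for noncommutative rings, called
    [ncring] below, work in any ring. *)
#[global] Instance nc_ops (A : pzRingType) :
  @Ncring.Ring_ops A 0 1 +%R *%R (fun x y => x - y) -%R eq := {}.
#[global] Instance nc_ring (A : pzRingType) : Ncring.Ring (Ro := nc_ops A).
Proof.
split.
- exact: RelationClasses.eq_equivalence.
- by move=> x y exy z t ezt; congr (_ + _).
- by move=> x y exy z t ezt; congr (_ * _).
- by move=> x y exy z t ezt; congr (_ - _).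
- by move=> x y exy; congr (- _).
- exact: (@add0r A).
- exact: (@addrC A).
- exact: (@addrA A).
- exact: (@mul1r A).
- exact: (@mulr1 A).
- exact: (@mulrA A).
- exact: (@mulrDl A).
- by move=> x y z; exact: (@mulrDr A).
- by [].
- exact: (@subrr A).
Qed.
Ltac ncring := Ncring_tac.non_commutative_ring.

Section JordanDerivation.
Variable A : pzRingType.

(** Reduces an equation that is a consequence of a known one, up to the ring
    axioms, to a ring identity; applied several times it combines several known
    equations, taken with [esym] when they have to be subtracted. *)
Lemma eq_of_subr (l r x y : A) : l = r -> x - y = l - r -> x = y.
Proof. by move=> -> /eqP; rewrite subrr subr_eq0 => /eqP. Qed.

Variable d : {additive A -> A}.
Hypothesis twoA : forall x : A, x + x = 0 -> x = 0.
Hypothesis semiA : forall x : A, (forall t, x * t * x = 0) -> x = 0.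
Hypothesis d_sqr : forall a : A, d (a * a) = d a * a + a * d a.

Lemma raddf3 x y z : d (x + y + z) = d x + d y + d z.
Proof. by rewrite !raddfD. Qed.

Lemma jordan_lin a b : d (a * b + b * a) = d a * b + a * d b + d b * a + b * d a.
Proof.
have E := d_sqr (a + b).
have F : (a + b) * (a + b) = a * a + (a * b + b * a) + b * b by ncring.
rewrite F raddf3 !d_sqr [d (a + b)]raddfD in E.
apply: (eq_of_subr E); ncring.
Qed.

(** [2 a b a] is obtained from [a], [b] by anticommutators and squares alone. *)
Lemma jordan_triple a b : d (a * b * a) = d a * b * a + a * d b * a + a * b * d a.
Proof.
have E := jordan_lin a (a * b + b * a).
have F : a * (a * b + b * a) + (a * b + b * a) * a =
  a * a * b + b * (a * a) + (a * b * a + a * b * a) by ncring.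
rewrite F raddfD !jordan_lin d_sqr [d (a*b*a + _)]raddfD in E.
apply: subr0_eq; apply: twoA.
apply: (eq_of_subr E); ncring.
Qed.

Lemma jordan_triple_lin a b c : d (a * b * c + c * b * a) =
  d a * b * c + a * d b * c + a * b * d c + (d c * b * a + c * d b * a + c * b * d a).
Proof.
have E := jordan_triple (a + c) b.
have F : (a + c) * b * (a + c) = a * b * a + (a * b * c + c * b * a) + c * b * c
  by ncring.
rewrite F raddf3 !jordan_triple [d (a + c)]raddfD in E.
apply: (eq_of_subr E); ncring.
Qed.

Definition defect a b := d (a * b) - d a * b - a * d b.

Lemma defectDl a a' b : defect (a + a') b = defect a b + defect a' b.
Proof. rewrite /defect mulrDl !raddfD; ncring. Qed.

Lemma defectDr a b b' : defect a (b + b') = defect a b + defect a b'.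
Proof. rewrite /defect mulrDr !raddfD; ncring. Qed.

Lemma defect_anti a b : defect b a = - defect a b.
Proof.
have E := jordan_lin a b; rewrite raddfD in E.
rewrite /defect; apply: (eq_of_subr E); ncring.
Qed.

Let comm (a b : A) := a * b - b * a.

(** The element [ab x ba + ba x ab] is a linearized triple product in two ways:
    of [ab], [x], [ba], and as [a (bxb) a + b (axa) b].  Comparing the values of
    [d] computed either way leaves exactly this relation. *)
Lemma defect_comm a b x :
  defect a b * x * comm a b + comm a b * x * defect a b = 0.
Proof.
have E := jordan_triple_lin (a * b) x (b * a).
have F : (a * b) * x * (b * a) + (b * a) * x * (a * b) =
  a * (b * x * b) * a + b * (a * x * a) * b by ncring.
rewrite F raddfD !jordan_triple in E.
have G := defect_anti a b; rewrite /defect in G.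
have Hb : d (b * a) = d b * a + b * d a - (d (a * b) - d a * b - a * d b).
  by apply: (eq_of_subr G); ncring.
rewrite Hb in E; rewrite /defect /comm.
apply: (eq_of_subr E); ncring.
Qed.

(** Moving factors across with the hypothesis shows that [z = p x q] satisfies
    [z t z = - z t z] for all [t]. *)
Lemma anticomm_mul0 (p q : A) : (forall x, p * x * q + q * x * p = 0) ->
  forall x, p * x * q = 0.
Proof.
move=> H x; apply: semiA => t; apply: twoA.
have E y : q * y * p = - (p * y * q).
  by apply: (eq_of_subr (H y)); ncring.
have E1 : p * x * q * t * (p * x * q) = - (p * x * p * t * q * x * q).
  transitivity (p * x * (q * t * p) * x * q); first by ncring.
  rewrite E; ncring.
have E2 : p * x * q * t * (p * x * q) = p * x * p * t * q * x * q.
  transitivity (- (q * x * p) * t * (p * x * q)); first by rewrite E opprK.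
  transitivity (p * (x * p * t) * q * x * q); last by ncring.
  rewrite -[p * (x * p * t) * q]opprK -E; ncring.
by rewrite {1}E1 E2; ncring.
Qed.

Lemma mul0_swap (p q : A) : (forall x, p * x * q = 0) -> forall x, q * x * p = 0.
Proof.
move=> H x; apply: semiA => t.
transitivity (q * x * (p * t * q) * x * p); first by ncring.
by rewrite H mulr0 !mul0r.
Qed.

(** Linearizing in [a] gives [y = - y'] with [y t y' = 0] for all [t], so semiprimeness
    frees the first argument of the commutator from [a]; linearizing in [b] then
    frees the second one. *)
Lemma defect_mul_comm a b c e x : defect a b * x * comm c e = 0.
Proof.
have K0 u v y : defect u v * y * comm u v = 0.
  exact: (anticomm_mul0 (defect_comm u v)).
have K1 u v w y : defect u v * y * comm w v = 0.
  apply: semiA => t.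
  have E : defect u v * y * comm w v = - (defect w v * y * comm u v).
    have D := K0 (u + w) v y; rewrite defectDl in D.
    have D1 := K0 u v y; have D2 := K0 w v y; rewrite /comm in D D1 D2 *.
    apply: (eq_of_subr D); apply: (eq_of_subr (esym D1)).
    by apply: (eq_of_subr (esym D2)); ncring.
  rewrite {2}E.
  transitivity (- (defect u v * y * (comm w v * t * defect w v) * y * comm u v)).
    ncring.
  by rewrite (mul0_swap (K0 w v)) mulr0 !mul0r oppr0.
apply: semiA => t.
have E : defect a b * x * comm c e = - (defect a e * x * comm c b).
  have D := K1 a (b + e) c x; rewrite defectDr in D.
  have D1 := K1 a b c x; have D2 := K1 a e c x; rewrite /comm in D D1 D2 *.
  apply: (eq_of_subr D); apply: (eq_of_subr (esym D1)).
  by apply: (eq_of_subr (esym D2)); ncring.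
rewrite {2}E.
transitivity (- (defect a b * x * (comm c e * t * defect a e) * x * comm c b)).
  ncring.
by rewrite (mul0_swap (K1 a e c)) mulr0 !mul0r oppr0.
Qed.

(** The defect [p] annihilates all commutators, hence is central, and [2 p] is
    [d (ab - ba)] up to commutators.  As [p (ab - ba) = 0], applying [d] to it and
    multiplying by [p] gives [p^3 = 0], whence [p = 0]. *)
Lemma jordan_derivation_is_derivation a b : d (a * b) = d a * b + a * d b.
Proof.
suff: defect a b = 0.
  by move=> E; apply: (eq_of_subr E); rewrite /defect; ncring.
set p := defect a b.
have pK c e x : p * x * comm c e = 0 by exact: defect_mul_comm.
have pC e : p * e = e * p.
  apply: subr0_eq; apply: semiA => t.
  transitivity (p * (e * t) * comm p e - e * (p * t * comm p e)).
    by rewrite /comm; ncring.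
  by rewrite !pK mulr0 subr0.
have pq0 c e : p * comm c e = 0 by rewrite -[p]mulr1 pK.
have ppdq : p * p * d (comm a b) = 0.
  have pqx x : p * x * comm a b = 0 by [].
  move: (comm a b) (pq0 a b) pqx => q {}pq0 pqx; apply: twoA.
  have E := jordan_lin p q; rewrite -pC pq0 addr0 raddf0 in E.
  have D : p * (d p * q + p * d q + d q * p + q * d p) = 0 by rewrite -E mulr0.
  have D1 := pqx (d p); have D2 : p * q * d p = 0 by rewrite pq0 mul0r.
  have D3 : p * d q * p = p * p * d q by rewrite -[_ * p]pC mulrA.
  apply: (eq_of_subr D); apply: (eq_of_subr (esym D1)).
  apply: (eq_of_subr (esym D2)); apply: (eq_of_subr (esym D3)).
  ncring.
have ppp : p * p * p = 0.
  apply: twoA.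
  have E : d (comm a b) = p + p + comm (d a) b + comm a (d b).
    have G : defect b a = - p by exact: defect_anti.
    have -> : d (comm a b) = d (a * b) - d (b * a) by rewrite /comm raddfB.
    have -> : d (b * a) = d b * a + b * d a - p.
      by rewrite /defect in G; apply: (eq_of_subr G); ncring.
    have -> : d (a * b) = d a * b + a * d b + p.
      by rewrite /p /defect; ncring.
    rewrite /comm; ncring.
  have F x y : p * p * (p + p + x + y) =
      p * p * p + p * p * p + p * (p * x) + p * (p * y).
    by ncring.
  by move: ppdq; rewrite E F !pq0 !mulr0 !addr0.
have pp : p * p = 0.
  apply: semiA => t; transitivity (p * p * (t * p) * p); first by rewrite !mulrA.
  by rewrite -pC !mulrA ppp !mul0r.
by apply: semiA => t; rewrite -mulrA -[t * p]pC mulrA pp mul0r.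
Qed.
End JordanDerivation.

(** * Real commutative Banach algebras with |a|^2 <= |a^2 + b^2| *)

(** By a theorem of Arens, the algebras satisfying these axioms are the algebras
    of continuous real functions on compact spaces. The inequality [anorm_sqr] is
    what replaces the representation on such a space: it lets norms of elements be
    read off from sums of squares. *)
Record arens_algebra (R : realType) (B : comPzRingType)
    (c : {rmorphism R -> B}) (N : B -> R) : Prop := ArensAlgebra {
  anorm0_eq0 : forall a, N a = 0 -> a = 0;
  anormD : forall a b, N (a + b) <= N a + N b;
  anormM : forall a b, N (a * b) <= N a * N b;
  anormZ : forall r a, N (c r * a) = `|r| * N a;
  anorm_sqr : forall a b, N a ^+ 2 <= N (a ^+ 2 + b ^+ 2);
  acomplete : forall u : nat -> B,
    (forall e, 0 < e -> exists n0, forall m n, (n0 <= m)%N -> (n0 <= n)%N ->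
      N (u m - u n) <= e) ->
    exists l, forall e, 0 < e -> exists n0, forall n, (n0 <= n)%N ->
      N (u n - l) <= e }.

Section ArensAlgebraTheory.
Variables (R : realType) (B : comPzRingType) (c : {rmorphism R -> B}).
Variable N : B -> R.
Hypothesis AN : arens_algebra c N.

Lemma anormN a : N (- a) = N a.
Proof. by have := anormZ AN (-1) a; rewrite rmorphN1 mulN1r normrN1 mul1r. Qed.

Lemma anormB a b : N (a - b) = N (b - a).
Proof. by rewrite -anormN opprB. Qed.

Lemma anorm0 : N 0 = 0.
Proof. by have := anormZ AN 0 0; rewrite rmorph0 mul0r normr0 mul0r. Qed.

Lemma anorm_ge0 a : 0 <= N a.
Proof. by have := anormD AN a (- a); rewrite subrr anorm0 anormN; lra. Qed.

Lemma anorm1_le1 : N 1 <= 1.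
Proof.
have := anorm_sqr AN 1 0; rewrite expr0n addr0 expr1n expr2.
by have := anorm_ge0 1; nra.
Qed.

Lemma anormX2_le a t : 0 <= t -> N (a ^+ 2) <= t ^+ 2 -> N a <= t.
Proof.
move=> t0 h; have := anorm_sqr AN a 0; rewrite expr0n addr0 => h1.
by rewrite -(ler_pXn2r (n := 2)) ?nnegrE ?anorm_ge0 // (le_trans h1).
Qed.

Definition aconv (u : nat -> B) (l : B) : Prop :=
  forall e, 0 < e -> exists n0, forall n, (n0 <= n)%N -> N (u n - l) <= e.

Lemma aconv_unique u l l' : aconv u l -> aconv u l' -> l = l'.
Proof.
move=> h h'; apply/eqP; rewrite -subr_eq0; apply/eqP/(anorm0_eq0 AN)/eqP.
rewrite eq_le anorm_ge0 andbT; apply/ler_addgt0Pr => e e0; rewrite add0r.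
have e2 : 0 < e / 2 by lra.
have [m hm] := h _ e2; have [n hn] := h' _ e2.
have := hm _ (leq_maxl m n); have := hn _ (leq_maxr m n).
set k := maxn m n => h1 h2.
have -> : l - l' = (u k - l') - (u k - l) by ring.
have := anormD AN (u k - l') (- (u k - l)); rewrite anormN; lra.
Qed.

Lemma aconv_norm_le u l t : aconv u l -> (forall n, N (u n) <= t) -> N l <= t.
Proof.
move=> h ht; apply/ler_addgt0Pr => e e0; have [n hn] := h _ e0.
have := anormD AN (u n) (- (u n - l)); rewrite anormN opprB addrC subrK.
have := hn _ (leqnn n); have := ht n; lra.
Qed.

(** A series dominated termwise by a convergent series of reals, written with
    partial sums. *)
Lemma acomplete_majorized (u : nat -> B) (s : nat -> R) t :
  (forall n, s n <= t) ->
  (forall n, N (u n.+1 - u n) <= s n.+1 - s n) ->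
  exists l, aconv u l.
Proof.
move=> st us.
have le_us m n : (n <= m)%N -> N (u m - u n) <= s m - s n.
  elim: m => [|m IH]; first by rewrite leqn0 => /eqP ->; rewrite !subrr anorm0.
  rewrite leq_eqVlt => /predU1P [->|]; first by rewrite !subrr anorm0.
  rewrite ltnS => /IH h; have -> : u m.+1 - u n = (u m.+1 - u m) + (u m - u n) by ring.
  have := anormD AN (u m.+1 - u m) (u m - u n); have := us m; lra.
apply: (acomplete AN) => e e0.
have hs : has_sup (range s).
  by split; [exists (s 0%N), 0%N | exists t => _ [n _ <-]].
have [_ [n0 _ <-] hn0] := sup_adherent e0 hs.
have le_sup n : s n <= sup (range s) by apply: (ub_le_sup hs.2); exists n.
have mono m n : (n <= m)%N -> s n <= s m.
  by move=> /le_us h; have := anorm_ge0 (u m - u n); lra.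
exists n0 => m n hm hn.
wlog nm : m n hm hn / (n <= m)%N.
  by move=> H; case: (leqP n m) => [/H|/ltnW/H]; [|rewrite anormB]; apply.
have := le_us _ _ nm; have := mono _ _ hn; have := le_sup m; lra.
Qed.

(** The fixed points of [y => (x + y^2) / 2] are the solutions of
    [(1 - y)^2 = 1 - x]. *)
Definition visser (x : B) (n : nat) : B :=
  iter n (fun y => c 2^-1 * (x + y ^+ 2)) 0.

Lemma visserS x n : visser x n.+1 = c 2^-1 * (x + visser x n ^+ 2).
Proof. by []. Qed.

Lemma half_mul2 : c 2^-1 * 2 = 1.
Proof. by rewrite -(rmorph_nat c) -rmorphM mulVf ?rmorph1 // pnatr_eq0. Qed.

(** The iterates for the scalar [x = 1]. The iterates are polynomials in [x] with
    nonnegative coefficients, and so are their successive differences; this scalar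
    sequence therefore majorizes them as soon as [N x <= 1], even at norm 1, where
    convergence is not geometric. *)
Definition visser_bound (n : nat) : R :=
  iter n (fun y => 2^-1 * (1 + y ^+ 2)) 0.

Lemma visser_boundS n : visser_bound n.+1 = 2^-1 * (1 + visser_bound n ^+ 2).
Proof. by []. Qed.

Lemma visser_bounds x (s := visser_bound) : N x <= 1 -> forall n,
  [/\ s n <= 1, N (visser x n) <= s n &
    N (visser x n.+1 - visser x n) <= s n.+1 - s n].
Proof.
move=> x1; elim=> [|n [s1 ns d]].
  rewrite /= anorm0 !subr0 expr0n addr0 (anormZ AN) gtr0_norm ?invr_gt0 //.
  by split; rewrite ?ler01 //; lra.
have e : s n.+2 - s n.+1 = 2^-1 * ((s n.+1 - s n) * (s n.+1 + s n)).
  by rewrite /s !visser_boundS; ring.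
have E : visser x n.+2 - visser x n.+1 = c 2^-1 *
    ((visser x n.+1 - visser x n) * (visser x n.+1 + visser x n)).
  by rewrite !visserS; ring.
have s0 := le_trans (anorm_ge0 _) ns.
have s1' : s n.+1 <= 1 by rewrite /s visser_boundS -/(s n); nra.
have ns' : N (visser x n.+1) <= s n.+1.
  rewrite visserS (anormZ AN) gtr0_norm ?invr_gt0 //.
  rewrite /s visser_boundS -/(s n) ler_pM2l ?invr_gt0 //.
  apply: (le_trans (anormD AN _ _)); apply: lerD => //.
  rewrite expr2; apply: (le_trans (anormM AN _ _)); rewrite expr2.
  by apply: ler_pM; rewrite ?anorm_ge0.
split=> //; rewrite e E (anormZ AN) gtr0_norm ?invr_gt0 //.
rewrite ler_pM2l ?invr_gt0 //; apply: (le_trans (anormM AN _ _)).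
apply: ler_pM; rewrite ?anorm_ge0 //.
exact: (le_trans (anormD AN _ _) (lerD ns' ns)).
Qed.

Lemma visser_limit x : N x <= 1 ->
  exists l, aconv (visser x) l /\ (1 - l) ^+ 2 = 1 - x.
Proof.
move=> x1; have vb := visser_bounds x1.
have [l vl] : exists l, aconv (visser x) l.
  by apply: (acomplete_majorized (s := visser_bound) (t := 1)) => n; have [] := vb n.
have v1 n : N (visser x n) <= 1 by have [h h' _] := vb n; apply: le_trans h.
have l1 := aconv_norm_le vl v1.
exists l; split=> //.
have el : l = c 2^-1 * (x + l ^+ 2).
  apply: (@aconv_unique (fun n => visser x n.+1)) => e e0.
    by have [n hn] := vl _ e0; exists n => m nm; apply/hn/leqW.
  have [n hn] := vl _ e0; exists n => m /hn h; rewrite visserS.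
  have -> : c 2^-1 * (x + visser x m ^+ 2) - c 2^-1 * (x + l ^+ 2) =
    c 2^-1 * ((visser x m - l) * (visser x m + l)) by ring.
  rewrite (anormZ AN) gtr0_norm ?invr_gt0 //.
  have h2 : N (visser x m + l) <= 2.
    by have := anormD AN (visser x m) l; have := v1 m; lra.
  have := anormM AN (visser x m - l) (visser x m + l).
  have := anorm_ge0 (visser x m - l); nra.
have e2 : 2 * l = x + l ^+ 2 by rewrite {1}el mulrA [2 * _]mulrC half_mul2 mul1r.
have -> : x = 2 * l - l ^+ 2 by rewrite e2; ring.
ring.
Qed.

(** Positivity is being a square, so that products of positive elements are
    visibly positive; that sums are takes the norm criterion of [psd_norm_sub] and
    [psd_of_norm_sub]. *)
Definition psd (a : B) : Prop := exists b, a = b ^+ 2.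

Lemma psd_one_sub x : N x <= 1 -> psd (1 - x).
Proof. by move=> /visser_limit [l [_ <-]]; exists (1 - l). Qed.

Lemma psd_sqr a : psd (a ^+ 2). Proof. by exists a. Qed.

Lemma psdM a b : psd a -> psd b -> psd (a * b).
Proof. by move=> [x ->] [y ->]; exists (x * y); rewrite exprMn. Qed.

Lemma psdC r : 0 <= r -> psd (c r).
Proof. by move=> r0; exists (c (Num.sqrt r)); rewrite -rmorphXn sqr_sqrtr. Qed.

Lemma psd1 : psd 1. Proof. by exists 1; rewrite expr1n. Qed.

(** Write [1 - a^2 = d^2]: then [a^2 + d^2 = 1] bounds [d], hence [d^2]. *)
Lemma anorm1_sub_sqr a : N a <= 1 -> N (1 - a ^+ 2) <= 1.
Proof.
move=> a1; have [|d Ed] := @psd_one_sub (a ^+ 2).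
  by rewrite expr2 (le_trans (anormM AN _ _)) // mulr_ile1 ?anorm_ge0.
have h := anorm_sqr AN d a; rewrite -Ed subrK in h.
rewrite Ed expr2 (le_trans (anormM AN _ _)) // -expr2.
exact: le_trans h anorm1_le1.
Qed.

Lemma psd_norm_sub a t : 0 < t -> psd a -> N a <= t -> N (c t - a) <= t.
Proof.
move=> t0 [b ->] bt; have rt0 : 0 < Num.sqrt t by rewrite sqrtr_gt0.
have b1 : N (c (Num.sqrt t)^-1 * b) <= 1.
  rewrite (anormZ AN) gtr0_norm ?invr_gt0 // ler_pdivrMl // mulr1.
  by apply: anormX2_le; rewrite ?sqr_sqrtr // ltW.
have := anorm1_sub_sqr b1.
have -> : c t - b ^+ 2 = c t * (1 - (c (Num.sqrt t)^-1 * b) ^+ 2).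
  rewrite mulrBr mulr1 exprMn mulrA -rmorphXn exprVn sqr_sqrtr ?ltW //.
  by rewrite -rmorphM mulfV ?gt_eqF // rmorph1 mul1r.
by rewrite (anormZ AN) gtr0_norm // ger_pMr.
Qed.

Lemma psd_of_norm_sub a t : 0 < t -> N (c t - a) <= t -> psd a.
Proof.
move=> t0 h.
have -> : a = c t * (1 - c t^-1 * (c t - a)).
  by rewrite mulrBr mulrA -rmorphM mulfV ?gt_eqF // rmorph1; ring.
apply: psdM; first exact/psdC/ltW.
by apply: psd_one_sub; rewrite (anormZ AN) gtr0_norm ?invr_gt0 // ler_pdivrMl // mulr1.
Qed.

(** The criterion [N (c t - a) <= t] is additive in the pair [(t, a)]. *)
Lemma psdD a b : psd a -> psd b -> psd (a + b).
Proof.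
move=> pa pb; have a0 := anorm_ge0 a; have b0 := anorm_ge0 b.
have ta : 0 < N a + 1 by lra. have tb : 0 < N b + 1 by lra.
apply: (@psd_of_norm_sub _ ((N a + 1) + (N b + 1))); first by lra.
have h := psd_norm_sub ta pa; have h' := psd_norm_sub tb pb.
have -> : c ((N a + 1) + (N b + 1)) - (a + b) =
  (c (N a + 1) - a) + (c (N b + 1) - b) by rewrite rmorphD; ring.
by apply: (le_trans (anormD AN _ _)); apply: lerD; [apply: h | apply: h']; lra.
Qed.

Lemma psd_anti a : psd a -> psd (- a) -> a = 0.
Proof.
move=> [b ->] [d Ed]; suff -> : b = 0 by rewrite expr0n.
apply: (anorm0_eq0 AN); have := anorm_sqr AN b d; rewrite -Ed subrr anorm0.
have := anorm_ge0 b; nra.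
Qed.

Lemma psd_add_eq0 a b : psd a -> psd b -> a + b = 0 -> a = 0.
Proof.
move=> pa pb /eqP; rewrite addr_eq0 => /eqP e.
by apply: psd_anti; rewrite // e opprK.
Qed.

Lemma sqr_eq0 (a : B) : a ^+ 2 = 0 -> a = 0.
Proof.
move=> a2; apply: (anorm0_eq0 AN); have := anorm_sqr AN a 0.
rewrite a2 expr0n addr0 anorm0.
have := anorm_ge0 a; nra.
Qed.

Lemma psd_closed u l t : aconv u l -> (forall n, psd (u n)) -> (forall n, N (u n) <= t) ->
  psd l.
Proof.
move=> ul pu ut; have t0 : 0 < t + 1 by have := le_trans (anorm_ge0 _) (ut 0%N); lra.
apply: (psd_of_norm_sub t0); apply/ler_addgt0Pr => e /ul [n /(_ _ (leqnn n)) h].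
have -> : c (t + 1) - l = (c (t + 1) - u n) + (u n - l) by ring.
apply: (le_trans (anormD AN _ _)); apply: lerD => //; apply: psd_norm_sub => //.
have := ut n; lra.
Qed.

(** The limit [1 - l] is the absolute value of [a], so the claim is [|a| + a >= 0].
    It holds along the iteration: [s_n = 1 - visser x n] satisfies
    [s_(n+1) + a = (s_n + a) (1 + a + visser x n) / 2]. *)
Lemma psd_sqrt_add a : N a <= 1 -> forall l, aconv (visser (1 - a ^+ 2)) l ->
  psd (1 - l + a).
Proof.
move=> a1 l vl; have x1 := anorm1_sub_sqr a1.
have px : psd (1 - a ^+ 2).
  by apply: psd_one_sub; rewrite expr2 (le_trans (anormM AN _ _)) // mulr_ile1 ?anorm_ge0.
set x := 1 - a ^+ 2 in vl x1 px.
have pv n : psd (visser x n).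
  elim: n => [|n IH]; first by exists 0; rewrite expr0n.
  by rewrite visserS; apply: psdM; [apply: psdC; rewrite invr_ge0 | apply/psdD/psd_sqr].
have pa : psd (1 + a) by rewrite -[a]opprK; apply: psd_one_sub; rewrite anormN.
have ps n : psd (1 - visser x n + a).
  elim: n => [|n IH]; first by rewrite /= subr0.
  have -> : 1 - visser x n.+1 + a =
      c 2^-1 * ((1 - visser x n + a) * (1 + a + visser x n)).
    transitivity (c 2^-1 * 2 * (1 + a) - c 2^-1 * (x + visser x n ^+ 2)).
      by rewrite half_mul2 visserS; ring.
    by rewrite /x; ring.
  apply: psdM; first by apply: psdC; rewrite invr_ge0.
  by apply: psdM => //; apply: psdD.
(* [3] bounds [N (1 - visser x n + a)], each of the three terms having norm at
   most 1. *)
apply: (@psd_closed _ _ 3 _ ps).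
  move=> e e0; have [n hn] := vl _ e0; exists n => m /hn.
  by rewrite anormB; congr (N _ <= _); ring.
move=> n; have [h1 h2 _] := visser_bounds x1 n.
have := anormD AN (1 - visser x n) a; have := anormD AN 1 (- visser x n).
by rewrite anormN; have := anorm1_le1; lra.
Qed.

Lemma psd_decomp a : exists p, [/\ psd p, psd (p - a) & p * (p - a) = 0].
Proof.
wlog a1 : a / N a <= 1.
  move=> H; have r0 : 0 < N a + 1 by have := anorm_ge0 a; lra.
  have [|p [pp pn p0]] := H (c (N a + 1)^-1 * a).
    rewrite (anormZ AN) gtr0_norm ?invr_gt0 // ler_pdivrMl // mulr1; lra.
  have e : c (N a + 1) * p - a = c (N a + 1) * (p - c (N a + 1)^-1 * a).
    by rewrite mulrBr mulrA -rmorphM mulfV ?gt_eqF // rmorph1 mul1r.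
  have pr : psd (c (N a + 1)) by apply/psdC/ltW.
  exists (c (N a + 1) * p); rewrite e; split; [exact: psdM | exact: psdM |].
  by rewrite mulrACA p0 mulr0.
have [l [vl sl]] := visser_limit (anorm1_sub_sqr a1).
have p1 := psd_sqrt_add a1 vl.
have p2 : psd (1 - l + - a) by apply: psd_sqrt_add; rewrite ?anormN // sqrrN.
exists (c 2^-1 * (1 - l + a)).
have e : c 2^-1 * (1 - l + a) - a = c 2^-1 * (1 - l + - a).
  by rewrite -{2}[a]mul1r -half_mul2; ring.
have ph : psd (c 2^-1) by apply: psdC; rewrite invr_ge0.
rewrite e; split; [exact: psdM | exact: psdM |].
have -> : c 2^-1 * (1 - l + a) * (c 2^-1 * (1 - l + - a)) =
  c 2^-1 ^+ 2 * ((1 - l) ^+ 2 - a ^+ 2) by ring.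
by rewrite sl; ring.
Qed.

(** * Positive parts and tent functions *)

Definition pospart a : B := sval (cid (psd_decomp a)).
Definition negpart a : B := pospart a - a.

Lemma pospart_psd a : psd (pospart a).
Proof. by rewrite /pospart; case: cid => p []. Qed.

Lemma negpart_psd a : psd (negpart a).
Proof. by rewrite /negpart /pospart; case: cid => p []. Qed.

Lemma pospart_mul_negpart a : pospart a * negpart a = 0.
Proof. by rewrite /negpart /pospart; case: cid => p []. Qed.

Lemma pospart_sub_negpart a : a = pospart a - negpart a.
Proof. by rewrite /negpart; ring. Qed.

#[local] Hint Resolve pospart_psd negpart_psd psd_sqr psd1 : core.

Lemma negpart_mul a : negpart a * a = - negpart a ^+ 2.
Proof.
rewrite {2}[a]pospart_sub_negpart mulrBr [_ * pospart a]mulrC.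
by rewrite pospart_mul_negpart sub0r.
Qed.

Lemma pospart_mulr a : pospart a * a = pospart a ^+ 2.
Proof. by rewrite {2}[a]pospart_sub_negpart mulrBr pospart_mul_negpart subr0. Qed.

Lemma psd_neg_eq0 (a : B) : psd a -> negpart a = 0.
Proof.
move=> pa; apply/sqr_eq0/psd_anti; first exact: psd_sqr.
by rewrite -negpart_mul; apply: psdM.
Qed.

Lemma psd_opp_pos_eq0 (a : B) : psd (- a) -> pospart a = 0.
Proof.
move=> pa; apply/sqr_eq0/psd_anti; first exact: psd_sqr.
by rewrite -pospart_mulr -mulrN; apply: psdM.
Qed.

(** Multiplying [a - b >= 0] by [a^- b^+ >= 0] gives a negative element, which
    therefore vanishes. *)
Lemma negpart_mul_pospart (a b : B) : psd (a - b) -> negpart a * pospart b = 0.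
Proof.
move=> pab; apply: sqr_eq0.
have E : negpart a * pospart b * (a - b) =
    - (negpart a ^+ 2 * pospart b + negpart a * pospart b ^+ 2).
  have -> : negpart a * pospart b * (a - b) =
    negpart a * a * pospart b - negpart a * (pospart b * b) by ring.
  by rewrite negpart_mul pospart_mulr; ring.
have p1 : psd (negpart a ^+ 2 * pospart b) by apply: psdM => //; exact: psd_sqr.
have p2 : psd (negpart a * pospart b ^+ 2) by apply: psdM => //; exact: psd_sqr.
have E0 : negpart a ^+ 2 * pospart b + negpart a * pospart b ^+ 2 = 0.
  by apply: psd_anti; [exact: psdD | rewrite -E; do 2?apply: psdM].
have -> : (negpart a * pospart b) ^+ 2 = negpart a ^+ 2 * pospart b * pospart b by ring.
by rewrite (psd_add_eq0 p1 p2 E0) mul0r.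
Qed.

(** For functions: where [b] is positive, [r] has the sign of [r * b]; where [b]
    vanishes, [r = r + b]. *)
Lemma psd_of_add_mul (r b : B) : psd b -> psd (r + b) -> psd (r * b) -> psd r.
Proof.
move=> pb prb pm.
have nb2 : negpart r ^+ 2 * b = 0.
  apply: psd_anti; first by apply: psdM => //; exact: psd_sqr.
  by rewrite -mulNr -negpart_mul -mulrA; apply: psdM.
have nb : negpart r * b = 0.
  by apply: sqr_eq0; rewrite exprMn [b ^+ 2]expr2 mulrA nb2 mul0r.
have n0 : negpart r = 0.
  apply/sqr_eq0/psd_anti; first exact: psd_sqr.
  by rewrite -[- _]addr0 -nb -negpart_mul -mulrDr; apply: psdM.
by rewrite [r]pospart_sub_negpart n0 subr0.
Qed.

Lemma pospart_mono (a b : B) : psd (a - b) -> psd (pospart a - pospart b).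
Proof.
move=> pab; apply: (psd_of_add_mul (pospart_psd b)); first by rewrite subrK.
have -> : (pospart a - pospart b) * pospart b = (a - b) * pospart b.
  transitivity ((a - b) * pospart b + negpart a * pospart b +
    (pospart b * b - pospart b ^+ 2)).
    by rewrite /negpart; ring.
  by rewrite negpart_mul_pospart // pospart_mulr subrr !addr0.
exact: psdM.
Qed.

Lemma negpart_mono (a b : B) : psd (a - b) -> psd (negpart b - negpart a).
Proof.
move=> pab; apply: (psd_of_add_mul (negpart_psd a)); first by rewrite subrK.
have -> : (negpart b - negpart a) * negpart a = (a - b) * negpart a.
  transitivity ((a - b) * negpart a + negpart a * pospart b -
    (negpart a * a + negpart a ^+ 2)).
    by rewrite /negpart; ring.
  by rewrite negpart_mul_pospart // negpart_mul addNr subr0 addr0.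
exact: psdM.
Qed.

(** [1 - a^2 = (1 - a) (1 + a)] is a square. *)
Lemma anorm_le1 (a : B) : psd a -> psd (1 - a) -> N a <= 1.
Proof.
move=> pa p1a; have p1 : psd (1 + a) by apply: psdD => //; exact: psd1.
have [d Ed] := psdM p1a p1.
have := anorm_sqr AN a d; rewrite -Ed.
have -> : a ^+ 2 + (1 - a) * (1 + a) = 1 by ring.
by have := anorm1_le1; have := anorm_ge0 a; nra.
Qed.

Lemma psd_nat n : psd (n%:R : B).
Proof.
elim: n => [|n IH]; first by exists 0; rewrite expr0n.
by rewrite -natr1; apply: psdD => //; exact: psd1.
Qed.

Lemma psd_natB m n : (m <= n)%N -> psd (n%:R - m%:R : B).
Proof. by move=> mn; rewrite -natrB //; exact: psd_nat. Qed.

Lemma psd_sum (I : Type) (r : seq I) (P : pred I) (F : I -> B) :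
  (forall i, psd (F i)) -> psd (\sum_(i <- r | P i) F i).
Proof.
move=> pF; apply: big_ind => [|x y px py|i _]; [|exact: psdD|exact: pF].
by exists 0; rewrite expr0n.
Qed.

(** For [i > 0] this is the truncation of [y - (i - 1)] to the interval from 0 to
    1; the value 1 at [i = 0] makes [tent y 0] equal to 1 at and below 0. *)
Definition clamp (y : B) (i : nat) : B :=
  if i is j.+1 then pospart (y - j%:R) - pospart (y - j.+1%:R) else 1.
Arguments clamp : simpl never.

Lemma clamp_psd y i : psd (clamp y i).
Proof.
case: i => [|i]; first exact: psd1.
apply: pospart_mono; have -> : y - i%:R - (y - i.+1%:R) = i.+1%:R - i%:R :> B by ring.
exact: psd_natB.
Qed.

Lemma one_sub_clampS y i : 1 - clamp y i.+1 = negpart (y - i.+1%:R) - negpart (y - i%:R).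
Proof. by rewrite /clamp /negpart -natr1; ring. Qed.

Lemma one_sub_clamp_psd y i : psd (1 - clamp y i).
Proof.
case: i => [|i]; first by rewrite subrr; exists 0; rewrite expr0n.
rewrite one_sub_clampS; apply: negpart_mono.
have -> : y - i%:R - (y - i.+1%:R) = i.+1%:R - i%:R :> B by ring.
exact: psd_natB.
Qed.

(** [clamp y i] equals 1 wherever a later [clamp y j] does not vanish.  The product
    [(1 - clamp y i) * clamp y j] expands into four products of a negative part
    and a positive part, all zero by [negpart_mul_pospart]. *)
Lemma clamp_mul y i j : (i < j)%N -> clamp y i * clamp y j = clamp y j.
Proof.
case: i => [|i]; first by rewrite mul1r.
case: j => // j ij; rewrite ltnS in ij.
have z s t : (s <= t)%N -> negpart (y - s%:R) * pospart (y - t%:R) = 0.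
  move=> st; apply: negpart_mul_pospart.
  have -> : y - s%:R - (y - t%:R) = t%:R - s%:R by ring.
  exact: psd_natB.
apply/eqP; rewrite -subr_eq0 -opprB oppr_eq0 -{1}[clamp y j.+1]mul1r -mulrBl.
rewrite one_sub_clampS.
rewrite [clamp y j.+1]/clamp mulrBl !mulrBr !z ?subrr //.
all: by rewrite ?(ltnW ij) ?leqW // ltnW.
Qed.

Definition tent y i : B := clamp y i - clamp y i.+1.

Lemma tent_psd y i : psd (tent y i).
Proof.
rewrite /tent; have -> : clamp y i - clamp y i.+1 = clamp y i * (1 - clamp y i.+1).
  by rewrite mulrBr mulr1 clamp_mul.
by apply: psdM; [exact: clamp_psd | exact: one_sub_clamp_psd].
Qed.

Lemma clamp_mul_tent y i j : (i.+1 < j)%N -> tent y i * clamp y j = 0.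
Proof. by move=> ij; rewrite /tent mulrBl !clamp_mul ?subrr //; exact: ltnW. Qed.

Lemma tent_mul y i j : (i.+1 < j)%N -> tent y i * tent y j = 0.
Proof.
by move=> ij; rewrite {2}/tent mulrBr !clamp_mul_tent ?subrr // ltnW.
Qed.

Lemma sum_tent y n : \sum_(i < n) tent y i = 1 - clamp y n.
Proof.
elim: n => [|n IH]; first by rewrite big_ord0 subrr.
by rewrite big_ord_recr /= IH /tent; ring.
Qed.

Lemma sum_clamp (y : B) n : psd y -> psd (n%:R - y) -> y = \sum_(i < n) clamp y i.+1.
Proof.
move=> py pny.
have -> : \sum_(i < n) clamp y i.+1 = pospart (y - 0%:R) - pospart (y - n%:R).
  elim: n {pny} => [|n IH]; first by rewrite big_ord0 subrr.
  by rewrite big_ord_recr /= IH /clamp; ring.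
rewrite subr0 (@psd_opp_pos_eq0 (y - n%:R)) ?opprB // subr0.
by rewrite {1}[y]pospart_sub_negpart psd_neg_eq0 // subr0.
Qed.

Lemma anorm_sum_tent y n (Q : pred nat) :
  N (\sum_(i < n | Q i) tent y i) <= 1.
Proof.
apply: anorm_le1; first by apply: psd_sum => i; exact: tent_psd.
have -> : 1 - \sum_(i < n | Q i) tent y i = \sum_(i < n | ~~ Q i) tent y i + clamp y n.
  have := sum_tent y n; rewrite (bigID (fun i : 'I_n => Q i)) /= => e.
  rewrite -[clamp y n](subKr 1) -e; ring.
by apply: psdD; [apply: psd_sum => i; exact: tent_psd | exact: clamp_psd].
Qed.

Lemma anorm_sum_tentS y n (Q : pred nat) :
  N (\sum_(i < n | Q i) tent y i.+1) <= 1.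
Proof.
have := @anorm_sum_tent y n.+1 (fun i => (0 < i)%N && Q i.-1).
by rewrite big_mkcond big_ord_recl /= add0r -big_mkcond.
Qed.

End ArensAlgebraTheory.

(** * Bilinear maps vanishing on orthogonal pairs *)

Section RealNorm.
Local Open Scope complex_scope.
Variables (R : realType) (V : normedModType R[i]).
Implicit Types x y : V.

(** The norm of a complex normed module takes its values in [R[i]]; estimates are
    made with this real version. *)
Definition rnorm x : R := complex.Re `|x|.

Lemma rnormE x : (rnorm x)%:C = `|x|.
Proof. by rewrite /rnorm; apply: RRe_real; rewrite normr_real. Qed.

Lemma rnorm_le x (t : R) : (rnorm x <= t) = (`|x| <= t%:C).
Proof. by rewrite -rnormE lecR. Qed.

Lemma rnorm_ge0 x : 0 <= rnorm x.
Proof. by rewrite -lecR rnormE normr_ge0. Qed.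

Lemma rnormD x y : rnorm (x + y) <= rnorm x + rnorm y.
Proof. by rewrite rnorm_le rmorphD /= !rnormE ler_normD. Qed.

Lemma rnormN x : rnorm (- x) = rnorm x.
Proof. by rewrite /rnorm normrN. Qed.

Lemma rnorm0_eq0 x : rnorm x = 0 -> x = 0.
Proof. by move=> h; apply/eqP; rewrite -normr_eq0 -rnormE h. Qed.

Lemma rnormMn x n : rnorm (x *+ n) = rnorm x *+ n.
Proof. by apply: complexI; rewrite rnormE normrMn -rnormE rmorphMn. Qed.

Lemma rnormZ (r : R) x : rnorm (r%:C *: x) = `|r| * rnorm x.
Proof.
apply: complexI; rewrite rnormE normrZ rmorphM /= rnormE normc_def /=.
by rewrite expr0n addr0 sqrtr_sqr.
Qed.

End RealNorm.

Section ZeroProduct.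
Local Open Scope complex_scope.
Variables (R : realType) (B : comPzRingType) (c : {rmorphism R -> B}).
Variable N : B -> R.
Hypothesis AN : arens_algebra c N.
Variables (V : normedModType R[i]) (phi : B -> B -> V) (K : R).
Hypothesis K_ge0 : 0 <= K.
Hypothesis phiDl : forall a a' b, phi (a + a') b = phi a b + phi a' b.
Hypothesis phiDr : forall a b b', phi a (b + b') = phi a b + phi a b'.
Hypothesis phi_le : forall a b, rnorm (phi a b) <= K * (N a * N b).
Hypothesis phi_zero : forall a b, a * b = 0 -> phi a b = 0.

Let om a b := phi a b - phi b a.
Let om0l b : om 0 b = 0. Proof. by rewrite /om !phi_zero ?mul0r ?mulr0 ?subrr. Qed.

Let om0r b : om b 0 = 0. Proof. by rewrite /om !phi_zero ?mul0r ?mulr0 ?subrr. Qed.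

Let omDl a a' b : om (a + a') b = om a b + om a' b.
Proof. by rewrite /om phiDl phiDr opprD addrACA. Qed.

Let omDr a b b' : om a (b + b') = om a b + om a b'.
Proof. by rewrite /om phiDl phiDr opprD addrACA. Qed.

Let om_zero a b : a * b = 0 -> om a b = 0.
Proof. by move=> ab; rewrite /om !phi_zero ?subrr // mulrC. Qed.

Let om_le a b : N a <= 1 -> N b <= 1 -> rnorm (om a b) <= 2 * K.
Proof.
move=> a1 b1; have h := rnormD (phi a b) (- phi b a); rewrite rnormN in h.
have phi_le1 u v : N u <= 1 -> N v <= 1 -> rnorm (phi u v) <= K.
  move=> u1 v1; apply: (le_trans (phi_le u v)).
  by rewrite ler_piMr // mulr_ile1 ?(anorm_ge0 AN).
by have := phi_le1 _ _ a1 b1; have := phi_le1 _ _ b1 a1; rewrite /om; lra.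
Qed.

Let om_suml n (P : pred 'I_n) (F : 'I_n -> B) b :
  om (\sum_(i < n | P i) F i) b = \sum_(i < n | P i) om (F i) b.
Proof. by apply: (big_morph (om^~ b)) => [x y|]. Qed.

Let om_sumr n (P : pred 'I_n) (F : 'I_n -> B) b :
  om b (\sum_(i < n | P i) F i) = \sum_(i < n | P i) om b (F i).
Proof. by apply: (big_morph (om b)) => [x y|]. Qed.

(* Writing [1 = (1 - clamp i) + tent i + clamp (i+1)] and
   [clamp (i+1) = tent (i+1) + clamp (i+2)], every other term vanishes by
   orthogonality, or because [om] is alternating. *)
Let om_clamp y i : om (clamp AN y i.+1) 1 = om (tent AN y i.+1) (tent AN y i).
Proof.
pose d := clamp AN y.
have -> : 1 = (1 - d i) + tent AN y i + d i.+1 by rewrite /tent /d; ring.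
rewrite omDr omDr om_zero; last by rewrite mulrBr mulr1 mulrC clamp_mul ?subrr.
rewrite /om subrr addr0 add0r -/(om _ _).
have {1}-> : clamp AN y i.+1 = tent AN y i.+1 + d i.+2 by rewrite /tent /d; ring.
by rewrite omDl [X in _ + X]om_zero ?addr0 // mulrC clamp_mul_tent.
Qed.

(* If the indices in [Q] are at least 3 apart, then [tent (i+1)] and [tent j] are
   orthogonal for distinct [i] and [j] in [Q], so the sum is a single value of
   [om]. *)
Let om_tent_le y n (Q : pred nat) :
    (forall i j, Q i -> Q j -> (i < j)%N -> (i.+2 < j)%N) ->
  rnorm (\sum_(i < n | Q i) om (tent AN y i.+1) (tent AN y i)) <= 2 * K.
Proof.
move=> sep.
have -> : \sum_(i < n | Q i) om (tent AN y i.+1) (tent AN y i) =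
    om (\sum_(i < n | Q i) tent AN y i.+1) (\sum_(i < n | Q i) tent AN y i).
  rewrite om_suml; apply: eq_bigr => i Qi.
  rewrite om_sumr (bigD1 i) //= big1 ?addr0 // => j /andP [Qj ij].
  apply: om_zero; case: (ltngtP i j) => [lij|lji|eij].
  - by apply: tent_mul; exact: sep.
  - by rewrite mulrC; apply: tent_mul; exact: ltnW (ltnW (sep _ _ Qj Qi lji)).
  - by rewrite (ord_inj eij) eqxx in ij.
by apply: om_le; [exact: (anorm_sum_tentS AN) | exact: (anorm_sum_tent AN)].
Qed.

(* [6 = 3 * 2]: one bound [2 * K] for each residue class modulo 3. *)
Let om_one_le y n : psd y -> psd (n%:R - y) -> rnorm (om y 1) <= 6 * K.
Proof.
move=> py pny; rewrite {1}(sum_clamp AN py pny) om_suml.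
under eq_bigr do rewrite om_clamp.
rewrite (partition_big (fun i : 'I_n => inord (i %% 3) : 'I_3) xpredT) //=.
have h r : rnorm (\sum_(i < n | inord (i %% 3) == r :> 'I_3)
    om (tent AN y i.+1) (tent AN y i)) <= 2 * K.
  apply: (@om_tent_le y n (fun i => inord (i %% 3) == r)) => i j /eqP <- /eqP e ij.
  have := congr1 val e; rewrite /= !inordK ?ltn_mod //; lia.
rewrite !big_ord_recr big_ord0 /= add0r.
set a := (X in X + _ + _); set b := (X in _ + X + _); set e := (X in _ + _ + X).
have ha : rnorm a <= 2 * K by exact: h.
have hb : rnorm b <= 2 * K by exact: h.
have he : rnorm e <= 2 * K by exact: h.
by have := rnormD (a + b) e; have := rnormD a b; lra.
Qed.

(** [y] is shifted to a positive element between 0 and [2 * k], which changes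
    [phi y 1 - phi 1 y] by nothing, and then multiplied by [n]: the bound [6 * K]
    on [n] times the norm of [phi y 1 - phi 1 y] does not depend on [n]. *)
Lemma zero_product_balanced y : phi y 1 = phi 1 y.
Proof.
have [k yk] : exists k, N y < k%:R by exists (Num.truncn (N y)).+1; exact: truncnS_gt.
have k0 : 0 < k%:R :> R by apply: le_lt_trans yk; exact: anorm_ge0 AN _.
have psk x : N x = N y -> psd (k%:R - x).
  move=> xy; rewrite -(rmorph_nat c); apply: (psd_of_norm_sub AN k0).
  by rewrite subKr xy ltW.
apply: subr0_eq; rewrite -/(om _ _); apply: rnorm0_eq0; apply/eqP.
rewrite eq_le rnorm_ge0 andbT leNgt; apply/negP => om0.
have om_n n : rnorm (om y 1) *+ n <= 6 * K.
  have -> : rnorm (om y 1) *+ n = rnorm (om ((y + k%:R) *+ n) 1).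
    rewrite -rnormMn; congr rnorm; elim: n => [|n IH]; first by rewrite !mulr0n om0l.
    rewrite !mulrS omDl -IH omDl; congr (_ + _).
    suff -> : om k%:R 1 = 0 by rewrite addr0.
    by elim: (k) => [|m IHm]; rewrite ?om0l // -natr1 omDl IHm /om subrr addr0.
  apply: (@om_one_le _ ((2 * k) * n)%N).
    rewrite -[_ *+ n]mulr_natl; apply: psdM; first exact: (psd_nat AN).
    by rewrite addrC -[y]opprK; apply: psk; rewrite (anormN AN).
  have -> : (2 * k * n)%:R - (y + k%:R) *+ n = n%:R * (k%:R - y) :> B.
    by rewrite -[_ *+ n]mulr_natl !natrM; ring.
  by apply: psdM; [exact: (psd_nat AN) | exact: psk].
have := om_n (Num.truncn (6 * K / rnorm (om y 1))).+1.
rewrite -[_ *+ _.+1]mulr_natl -ler_pdivlMr //; apply/negP; rewrite -ltNge.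
exact: truncnS_gt.
Qed.

End ZeroProduct.

(** * C*-algebras and the commutative algebra of a selfadjoint element *)

Section CStarBasics.
Local Open Scope complex_scope.
Variables (R : realType) (A : unitalCStarAlgType R).
Implicit Types x y z : A.

Lemma cstar_scalerAl (k : R[i]) x y : (k *: x) * y = k *: (x * y).
Proof. exact: cmulZl. Qed.

Lemma cstar_scalerAr (k : R[i]) x y : x * (k *: y) = k *: (x * y).
Proof. exact: cmulZr. Qed.

Lemma starM x y : star (x * y) = star y * star x.
Proof. exact: cstarM. Qed.

Lemma star1 : star (1 : A) = 1.
Proof. by rewrite -[LHS]mulr1 -{2}[1]starK -starM mulr1 starK. Qed.

Lemma star0 : star (0 : A) = 0.
Proof. by have := starZ 0 (0 : A); rewrite !scale0r rmorph0 scale0r. Qed.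

Lemma starN x : star (- x) = - star x.
Proof. by have := starZ (-1) x; rewrite rmorphN1 !scaleN1r. Qed.

Lemma starB x y : star (x - y) = star x - star y.
Proof. by rewrite starD starN. Qed.

Lemma starZC (r : R) x : star (r%:C *: x) = r%:C *: star x.
Proof. by rewrite starZ conj_Creal // realE !lecR -realE num_real. Qed.

Lemma rnormM x y : rnorm (x * y) <= rnorm x * rnorm y.
Proof. by rewrite rnorm_le rmorphM /= !rnormE; exact: cnormM. Qed.

Lemma rnorm_star_mul x : rnorm (star x * x) = rnorm x ^+ 2.
Proof. by apply: complexI; rewrite rnormE rmorphXn /= rnormE; exact: cstar_norm. Qed.

Lemma rnorm_star x : rnorm (star x) = rnorm x.
Proof.
suff le y : rnorm y <= rnorm (star y).
  by apply/eqP; rewrite eq_le le andbT -{2}[x]starK le.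
have [->|y0] := eqVneq (rnorm y) 0; first exact: rnorm_ge0.
have yp : 0 < rnorm y by rewrite lt0r y0 rnorm_ge0.
by rewrite -(ler_pM2r yp) -expr2 -rnorm_star_mul rnormM.
Qed.

Lemma star_mul_eq0 x : star x * x = 0 -> x = 0.
Proof.
move=> x0; apply/rnorm0_eq0/eqP; rewrite -sqrf_eq0 -rnorm_star_mul x0.
by rewrite /rnorm normr0.
Qed.

Lemma cstar_semiprime x : (forall t, x * t * x = 0) -> x = 0.
Proof.
move=> h; apply/star_mul_eq0/star_mul_eq0.
by rewrite starM starK -[star x * x * _]mulrA [x * _]mulrA h mulr0.
Qed.

Lemma twice_eq0 x : x + x = 0 -> x = 0.
Proof.
move=> /eqP; rewrite -mulr2n -scaler_nat scaler_eq0 pnatr_eq0 /= => /eqP //.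
Qed.

Lemma cauchy_limit (u : nat -> A) :
  (forall e : R, 0 < e -> exists n0, forall m n, (n0 <= m)%N -> (n0 <= n)%N ->
      rnorm (u m - u n) <= e) ->
  exists l, forall e : R, 0 < e -> exists n0, forall n, (n0 <= n)%N ->
      rnorm (u n - l) <= e.
Proof.
move=> uc.
have /cauchy_cvg ul : cauchy (u @ \oo)%classic.
  apply: cauchy_exP => e e0.
  have ec : e = (complex.Re e)%:C by rewrite RRe_real // ger0_real // ltW.
  have e1 : 0 < complex.Re e by rewrite -ltcR -ec.
  have [|n0 hn] := uc (complex.Re e / 2); first by lra.
  exists (u n0); exists n0 => // n /= n0n; rewrite -ball_normE /ball_ /=.
  rewrite ec -rnormE ltcR; apply: le_lt_trans (hn _ _ (leqnn _) n0n) _; lra.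
exists (lim (u @ \oo))%classic => e e0.
have e1 : 0 < e%:C :> R[i] by rewrite ltcR.
have /cvgrPdist_le /(_ _ e1) [n0 _ hn] := ul.
by exists n0 => n n0n; rewrite rnorm_le distrC; apply: hn.
Qed.

(** [x] is the real part of [u = x + i y], and [u^* u = x^2 + y^2] because [x] and
    [y] commute. *)
Lemma rnorm_sqr_le_add x y : star x = x -> star y = y -> x * y = y * x ->
  rnorm x ^+ 2 <= rnorm (x ^+ 2 + y ^+ 2).
Proof.
move=> sx sy xy; pose u := x + 'i *: y.
have su : star u = x - 'i *: y by rewrite /u starD starZ sx sy conjCi scaleNr.
have -> : x ^+ 2 + y ^+ 2 = star u * u.
  rewrite su /u mulrDr !mulrBl !cstar_scalerAl !cstar_scalerAr xy scalerA.
  rewrite -['i * _]expr2 sqrCi.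
  by rewrite scaleN1r opprK addrA subrK -!expr2.
have ux : x = 2^-1%:C *: (u + star u).
  rewrite su /u addrACA subrr addr0 -mulr2n -[x *+ 2]scaler_nat scalerA.
  by rewrite -(rmorph_nat (@real_complex R)) -rmorphM mulVf ?pnatr_eq0 // scale1r.
rewrite rnorm_star_mul ler_pXn2r ?nnegrE ?rnorm_ge0 //.
rewrite {1}ux rnormZ gtr0_norm ?invr_gt0 //.
by have := rnormD u (star u); rewrite rnorm_star; lra.
Qed.

Lemma rnorm_lim_eq x y : (forall e : R, 0 < e -> rnorm (x - y) <= e) -> x = y.
Proof.
move=> le; apply: subr0_eq; apply: rnorm0_eq0; apply/eqP.
rewrite eq_le rnorm_ge0 andbT; apply/ler_addgt0Pr => e e0.
by rewrite add0r le.
Qed.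

End CStarBasics.

Section Bicommutant.
Local Open Scope complex_scope.
Variables (R : realType) (A : unitalCStarAlgType R) (h : A).

(** The selfadjoint part of the bicommutant of [h], for selfadjoint [h]. It is used
    instead of the closed algebra generated by [h] because it is commutative and
    closed by inspection. *)
Definition in_bicommutant : {pred A} := fun a =>
  `[< star a = a /\ forall x, x * h = h * x -> x * a = a * x >].

Lemma bicommutant_comm a b : a \in in_bicommutant -> b \in in_bicommutant ->
  a * b = b * a.
Proof.
move=> /asboolP [_ ha] /asboolP [_ hb]; apply: hb.
by rewrite -ha.
Qed.

Lemma bicommutant_subring : subring_closed in_bicommutant.
Proof.
split.
- by apply/asboolP; split; [exact: star1 | move=> x _; rewrite mulr1 mul1r].
- move=> a b /asboolP [sa ha] /asboolP [sb hb]; apply/asboolP; split.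
    by rewrite starB sa sb.
  by move=> x xh; rewrite mulrBr mulrBl ha // hb.
- move=> a b Ba Bb; have ab := bicommutant_comm Ba Bb.
  move: Ba Bb => /asboolP [sa ha] /asboolP [sb hb]; apply/asboolP; split.
    by rewrite starM sa sb.
  by move=> x xh; rewrite mulrA ha // -mulrA hb // mulrA.
Qed.

HB.instance Definition _ := GRing.isSubringClosed.Build A in_bicommutant
  bicommutant_subring.

Record bicommutant := Bicommutant { bval : A ; bvalP : bval \in in_bicommutant }.
HB.instance Definition _ := [isSub for bval].
HB.instance Definition _ := [Choice of bicommutant by <:].
HB.instance Definition _ :=
  GRing.SubChoice_isSubPzRing.Build A in_bicommutant bicommutant bicommutant_subring.

Lemma bicommutant_mulC : commutative (@GRing.mul bicommutant).
Proof. by move=> a b; apply/val_inj/bicommutant_comm; exact: bvalP. Qed.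

HB.instance Definition _ :=
  GRing.PzRing_hasCommutativeMul.Build bicommutant bicommutant_mulC.

Lemma bscalar_subproof (r : R) : r%:C *: (1 : A) \in in_bicommutant.
Proof.
apply/asboolP; split; first by rewrite starZC star1.
by move=> x _; rewrite cstar_scalerAl cstar_scalerAr mulr1 mul1r.
Qed.

Definition bscalar (r : R) : bicommutant := Bicommutant (bscalar_subproof r).

Lemma bscalar_zmod : zmod_morphism bscalar.
Proof. by move=> r s; apply: val_inj; rewrite /= rmorphB scalerBl. Qed.

Lemma bscalar_monoid : monoid_morphism bscalar.
Proof.
split; first by apply: val_inj; rewrite /= scale1r.
by move=> r s; apply: val_inj; rewrite /= cstar_scalerAl mul1r rmorphM scalerA.
Qed.

HB.instance Definition _ :=
  GRing.isZmodMorphism.Build R bicommutant bscalar bscalar_zmod.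
HB.instance Definition _ :=
  GRing.isMonoidMorphism.Build R bicommutant bscalar bscalar_monoid.

Lemma bvalD (a b : bicommutant) : bval (a + b) = bval a + bval b.
Proof. by []. Qed.

Lemma bval_star (a : bicommutant) : star (bval a) = bval a.
Proof. by have /asboolP [] := bvalP a. Qed.

Lemma bicommutant_arens : arens_algebra bscalar (fun a : bicommutant => rnorm (bval a)).
Proof.
split.
- by move=> a /rnorm0_eq0 a0; exact: val_inj.
- by move=> a b; exact: rnormD.
- by move=> a b; exact: rnormM.
- by move=> r a; rewrite /= cstar_scalerAl mul1r rnormZ.
- move=> a b; apply: rnorm_sqr_le_add; rewrite ?bval_star //.
  exact: bicommutant_comm (bvalP a) (bvalP b).
- move=> u uc; have [l ul] := @cauchy_limit _ _ (bval \o u) uc.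
  suff lB : l \in in_bicommutant by exists (Bicommutant lB).
  apply/asboolP; split.
    apply: rnorm_lim_eq => e e0.
    have [|n /(_ _ (leqnn n)) /= ln] := ul (e / 2); first by lra.
    have -> : star l - l = star (l - bval (u n)) + (bval (u n) - l).
      by rewrite starB bval_star addrA subrK.
    have := rnormD (star (l - bval (u n))) (bval (u n) - l).
    rewrite rnorm_star -[rnorm (l - _)]rnormN opprB; lra.
  move=> x xh; apply: rnorm_lim_eq => e e0.
  have r0 : 0 < 2 * rnorm x + 1 by have := rnorm_ge0 x; lra.
  have [|n /(_ _ (leqnn n)) /= ln] := ul (e / (2 * rnorm x + 1)).
    exact: divr_gt0.
  have /asboolP [_ /(_ x xh) xu] := bvalP (u n).
  have -> : x * l - l * x = (bval (u n) - l) * x + - (x * (bval (u n) - l)).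
    by rewrite mulrBl mulrBr xu opprB [RHS]addrC addrA subrK.
  apply: le_trans (rnormD _ _) _; rewrite rnormN.
  have := rnormM (bval (u n) - l) x; have := rnormM x (bval (u n) - l).
  have ln' : rnorm (bval (u n) - l) * (2 * rnorm x + 1) <= e by rewrite -ler_pdivlMr.
  have := rnorm_ge0 (bval (u n) - l); lra.
Qed.

End Bicommutant.

(** * Triple derivations at zero *)

Section TripleDerivationAtZero.
Local Open Scope complex_scope.
Variables (R : realType) (A : unitalCStarAlgType R) (T : {linear A -> A}).
Hypothesis dT : triple_derivation_at_zero T.
Hypothesis T1 : T 1 = 0.
Implicit Types a b x y : A.

Let half_eq0 x : (2%:R^-1 : R[i]) *: x = 0 -> x = 0.
Proof. by move=> /eqP; rewrite scaler_eq0 invr_eq0 pnatr_eq0 => /eqP. Qed.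

(** This is [triple a 1 b = 0]; the middle term drops out because [T 1 = 0]. *)
Lemma jordan_at_zero a b : a * b = 0 -> b * a = 0 ->
  T a * b + b * T a + (a * T b + T b * a) = 0.
Proof.
move=> ab ba; have := @dT a 1 b; rewrite /triple !star1 T1 star0.
rewrite !mulr1 mulr0 mul0r mulr0 mul0r add0r scaler0 addr0 -scalerDr.
by rewrite ab ba addr0 scaler0 => /(_ erefl)/half_eq0.
Qed.

(** This is [triple a b 1 = 0]; here the middle term brings in [star (T b)]. *)
Lemma jordan_star_at_zero a b : star b = b -> a * b = 0 -> b * a = 0 ->
  T a * b + b * T a + (a * star (T b) + star (T b) * a) = 0.
Proof.
move=> sb ab ba; have := @dT a b 1; rewrite /triple sb T1.
rewrite !mulr1 !mul1r mulr0 !mul0r addr0 scaler0 addr0 -scalerDr.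
by rewrite ab ba addr0 scaler0 => /(_ erefl)/half_eq0.
Qed.

Hypothesis bT : bounded_operator T.

Lemma rnorm_bounded : exists2 M, 0 <= M & forall x, rnorm (T x) <= M * rnorm x.
Proof.
have [M hM] := bT; exists `|M|; first exact: normr_ge0.
move=> x; rewrite rnorm_le rmorphM /= rnormE; apply: le_trans (hM x) _.
by rewrite ler_wpM2r // lecR ler_norm.
Qed.

(** The balance property of [phi a b = a o S b] with [S b = T b - star (T b)], which
    vanishes on orthogonal pairs by comparing the two preceding identities. *)
Lemma map_selfadjoint h : star h = h -> star (T h) = T h.
Proof.
move=> sh; have [M M0 TM] := rnorm_bounded.
pose S x := T x - star (T x).
have SD x y : S (x + y) = S x + S y.
  by rewrite /S raddfD starD opprD addrACA.
pose phi (a b : bicommutant h) := bval a * S (bval b) + S (bval b) * bval a.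
have hB : h \in in_bicommutant h by apply/asboolP; split.
have S_le x : rnorm (S x) <= 2 * M * rnorm x.
  have := rnormD (T x) (- star (T x)); rewrite rnormN rnorm_star.
  have := TM x; rewrite /S; lra.
suff E : phi (Bicommutant hB) 1 = phi 1 (Bicommutant hB).
  apply/esym/subr0_eq/twice_eq0; move: E; rewrite /phi /= mulr1 mul1r -/(S h).
  have -> : S 1 = 0 by rewrite /S T1 star0 subrr.
  by rewrite mulr0 mul0r addr0 => <-.
apply: (@zero_product_balanced _ _ _ _ (bicommutant_arens h) _ phi (4 * M)).
- lra.
- by move=> a a' b; rewrite /phi bvalD; ncring.
- by move=> a b b'; rewrite /phi bvalD SD; ncring.
- move=> a b; apply: le_trans (rnormD _ _) _.
  have := rnormM (bval a) (S (bval b)); have := rnormM (S (bval b)) (bval a).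
  have := ler_wpM2l (rnorm_ge0 (bval a)) (S_le (bval b)); lra.
- move=> a b ab; have ab' : bval a * bval b = 0 by exact: (congr1 (@bval _ _ _) ab).
  have ba' : bval b * bval a = 0 by rewrite mulrC in ab; exact: (congr1 (@bval _ _ _) ab).
  have E1 := jordan_at_zero ab' ba'.
  have E2 := jordan_star_at_zero (bval_star b) ab' ba'.
  by apply: (eq_of_subr (esym E2)); apply: (eq_of_subr E1); rewrite /phi /S; ncring.
Qed.

(** The Jordan derivation identity in its bilinear form, which can be extended by
    linearity in each argument. *)
Definition jordan_pair x y : Prop :=
  T (x * y + y * x) = T x * y + x * T y + (T y * x + y * T x).

(** The balance property of [phi a b = T (a * h) o b + (a * h) o T b]. The factor [h]
    is what produces [T (h * h)], and it preserves orthogonality since [a], [b] and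
    [h] commute. *)
Lemma jordan_pair_selfadjoint h : star h = h -> jordan_pair h h.
Proof.
move=> sh; have [M M0 TM] := rnorm_bounded.
have hB : h \in in_bicommutant h by apply/asboolP; split.
pose k := Bicommutant hB.
pose phi (a b : bicommutant h) := T (bval a * h) * bval b + bval b * T (bval a * h) +
  (bval a * h * T (bval b) + T (bval b) * (bval a * h)).
suff E : phi k 1 = phi 1 k.
  move: E; rewrite /phi /= !mulr1 !mul1r T1 mulr0 mul0r !addr0 => E.
  by rewrite /jordan_pair raddfD E; ncring.
apply: (@zero_product_balanced _ _ _ _ (bicommutant_arens h) _ phi
  (4 * (M * rnorm h))).
- by rewrite !mulr_ge0 ?rnorm_ge0.
- move=> a a' b; rewrite /phi bvalD mulrDl raddfD; ncring.
- move=> a b b'; rewrite /phi bvalD raddfD; ncring.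
- move=> a b; have h0 := rnorm_ge0 h; have a0 := rnorm_ge0 (bval a).
  have b0 := rnorm_ge0 (bval b); rewrite /phi.
  set x := bval a in a0 *; set y := bval b in b0 *.
  have xh : rnorm (x * h) <= rnorm x * rnorm h by exact: rnormM.
  have P : rnorm (T (x * h)) <= M * (rnorm x * rnorm h).
    by apply: le_trans (TM _) _; apply: ler_wpM2l.
  have Q := TM y.
  have E : M * (rnorm x * rnorm h) * rnorm y = M * rnorm h * (rnorm x * rnorm y) by ring.
  have E' : (rnorm x * rnorm h) * (M * rnorm y) = M * rnorm h * (rnorm x * rnorm y) by ring.
  have P1 := ler_pM (rnorm_ge0 _) b0 P (lexx (rnorm y)).
  have P2 := ler_pM (rnorm_ge0 _) (rnorm_ge0 _) xh Q.
  apply: le_trans (rnormD _ _) _.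
  have := rnormD (T (x * h) * y) (y * T (x * h)).
  have := rnormD (x * h * T y) (T y * (x * h)).
  have := rnormM (T (x * h)) y; have := rnormM y (T (x * h)).
  have := rnormM (x * h) (T y); have := rnormM (T y) (x * h); lra.
- move=> a b ab; have ab' : bval a * bval b = 0 by exact: (congr1 (@bval _ _ _) ab).
  have ba' : bval b * bval a = 0 by rewrite mulrC in ab; exact: (congr1 (@bval _ _ _) ab).
  have hb : h * bval b = bval b * h by exact: (congr1 (@bval _ _ _) (mulrC k b)).
  apply: jordan_at_zero; last by rewrite mulrA ba' mul0r.
  by rewrite -mulrA hb mulrA ab' mul0r.
Qed.

End TripleDerivationAtZero.

Section Extension.
Local Open Scope complex_scope.
Variables (R : realType) (A : unitalCStarAlgType R) (T : {linear A -> A}).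
Implicit Types a b x y z : A.

Let TD x y : T (x + y) = T x + T y. Proof. exact: linearD. Qed.

Lemma cartesian_decomposition a :
  exists x y, [/\ star x = x, star y = y & a = x + 'i *: y].
Proof.
exists (2^-1%:C *: (a + star a)), (2^-1%:C *: ('i *: (star a - a))); split.
- by rewrite starZC starD starK addrC.
- by rewrite starZC starZ starB starK conjCi scaleNr -scalerN opprB.
- rewrite scalerA ['i * _]mulrC -scalerA (scalerA 'i 'i) -expr2 sqrCi scaleN1r opprB.
  rewrite -scalerDr addrACA subrr addr0 -mulr2n -[a *+ 2]scaler_nat scalerA.
  by rewrite -(rmorph_nat (@real_complex R)) -rmorphM mulVf ?pnatr_eq0 // scale1r.
Qed.

Lemma jordan_pairC x y : jordan_pair T x y -> jordan_pair T y x.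
Proof. by rewrite /jordan_pair [y * x + _]addrC => ->; ncring. Qed.

Lemma jordan_pairDr x y z :
  jordan_pair T x y -> jordan_pair T x z -> jordan_pair T x (y + z).
Proof.
rewrite /jordan_pair => E F.
have -> : x * (y + z) + (y + z) * x = (x * y + y * x) + (x * z + z * x) by ncring.
by rewrite (TD (x * y + y * x)) E F (TD y); ncring.
Qed.

Lemma jordan_pairZr (k : R[i]) x y :
  jordan_pair T x y -> jordan_pair T x (k *: y).
Proof.
rewrite /jordan_pair => E.
rewrite cstar_scalerAl cstar_scalerAr -scalerDr !linearZ /= E.
by rewrite !cstar_scalerAl !cstar_scalerAr -!scalerDr.
Qed.

Lemma jordan_pair_total :
  (forall h, star h = h -> jordan_pair T h h) -> forall a b, jordan_pair T a b.
Proof.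
move=> J.
have Jsa x y : star x = x -> star y = y -> jordan_pair T x y.
  move=> sx sy; have sxy : star (x + y) = x + y by rewrite starD sx sy.
  have := J _ sxy; have := J _ sx; have := J _ sy; rewrite /jordan_pair => Ey Ex E.
  apply: subr0_eq; apply: twice_eq0.
  have F : (x + y) * (x + y) + (x + y) * (x + y) =
    (x * x + x * x) + (y * y + y * y) + ((x * y + y * x) + (x * y + y * x)) by ncring.
  rewrite F (TD (x * x + x * x + _)) (TD (x * x + x * x)) Ex Ey in E.
  rewrite (TD (x * y + y * x)) (TD x) in E.
  by apply: (eq_of_subr E); ncring.
have Jl x b : star x = x -> jordan_pair T x b.
  move=> sx; have [y [z [sy sz ->]]] := cartesian_decomposition b.
  by apply: jordan_pairDr; [exact: Jsa | apply/jordan_pairZr/Jsa].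
move=> a b; have [y [z [sy sz ->]]] := cartesian_decomposition a.
apply: jordan_pairC; apply: jordan_pairDr; last apply: jordan_pairZr.
all: by apply: jordan_pairC; exact: Jl.
Qed.

Lemma map_star_of_selfadjoint :
  (forall h, star h = h -> star (T h) = T h) -> forall a, T (star a) = star (T a).
Proof.
move=> S a; have [x [y [sx sy ->]]] := cartesian_decomposition a.
by rewrite !(linearD, linearZ) /= !starD !starZ linearD linearZ /= sx sy !S.
Qed.

Lemma triple_derivation_of_star_derivation : star_derivation T -> triple_derivation T.
Proof.
move=> [Dm Ds] a b c; rewrite /triple linearZ /= linearD !Dm !Ds -!scalerDr.
by congr (_ *: _); ncring.
Qed.

End Extension.

Theorem corollary2p10 (R : realType) (A : unitalCStarAlgType R)
    (T : {linear A -> A}) (bT : bounded_operator T)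
    (dT : triple_derivation_at_zero T) (T1 : T 1 = 0) :
  star_derivation T /\ triple_derivation T.
Proof.
suff D : star_derivation T by split=> //; exact: triple_derivation_of_star_derivation.
split; last by apply: map_star_of_selfadjoint => h; exact: map_selfadjoint.
have J := jordan_pair_total (jordan_pair_selfadjoint dT T1 bT).
apply: jordan_derivation_is_derivation => [x|x|a].
- exact: twice_eq0.
- exact: cstar_semiprime.
- have := J a a; rewrite /jordan_pair raddfD => E.
  by apply: subr0_eq; apply: twice_eq0; apply: (eq_of_subr E); ncring.
Qed.
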